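(* Let $S=\langle n_1,n_2,n_3,n_4\rangle$ be a numerical semigroup with embedding dimension $4$, where $n_1<n_2<n_3<n_4$ are its minimal generators. If $S$ is nearly Gorenstein, then $t(S)\le 3$. Moreover, let $(f_1,f_2,f_3,f_4)$ be any NG-vector for $S$. If $S$ is not almost symmetric and $i$ is the minimum index such that $f_i\neq f_1$, then there exist $l<i$, indices $j,k$ with $\{i,j,k,l\}=\{1,2,3,4\}$, and $\lambda\in\mathbb{N}$ such that either \[ \mathrm{PF}(S)=\{\mathrm{F}(S),\ \mathrm{F}(S)-n_i+n_l\} \] or \[ \mathrm{PF}(S)=\{\mathrm{F}(S),\ \mathrm{F}(S)-n_i+n_l,\ \lambda n_k-n_j\}. \]
   Context: A numerical semigroup is a submonoid $S$ of $\mathbb{N}=\{0,1,2,\dots\}$ with $\mathbb{N}\setminus S$ finite. $\langle n_1,\dots,n_\nu\rangle$ denotes the set of all $\mathbb{N}$-linear combinations of $n_1,\dots,n_\nu$. Every numerical semigroup has a unique minimal set of generators $\mathrm{G}(S)$, which is finite; its cardinality is the embedding dimension of $S$. $\mathrm{F}(S)=\max(\mathbb{Z}\setminus S)$ is the Frobenius number. $\mathrm{PF}(S)=\{f\in\mathbb{Z}\setminus S : f+s\in S \text{ for all } s\in S\setminus\{0\}\}$ is the set of pseudo-Frobenius numbers, and $t(S)=|\mathrm{PF}(S)|$ is the type of $S$. Put $M(S)=S\setminus\{0\}$, $K(S)=\{z\in\mathbb{Z} : \mathrm{F}(S)-z\notin S\}$, and $S-K(S)=\{z\in\mathbb{Z}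 : z+K(S)\subseteq S\}$. $S$ is almost symmetric if $M(S)+K(S)=M(S)$, and nearly Gorenstein if $M(S)\subseteq K(S)+(S-K(S))$. If $n_1<\dots<n_\nu$ are the minimal generators of $S$, an NG-vector for $S$ is a vector $(f_1,\dots,f_\nu)\in\mathrm{PF}(S)^\nu$ such that $n_i+f_i-f\in S$ for every $f\in\mathrm{PF}(S)$ and every $i=1,\dots,\nu$. $S$ is nearly Gorenstein if and only if it admits an NG-vector; an NG-vector need not be unique. *)

(* Defs.v *)
From mathcomp Require Import all_boot all_order all_algebra.
From mathcomp Require Import finmap.
From mathcomp Require Import boolp classical_sets functions cardinality.

Set Implicit Arguments.
Unset Strict Implicit.
Unset Printing Implicit Defensive.

Import Order.TTheory GRing.Theory Num.Theory.

Local Open Scope classical_set_scope.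
Local Open Scope ring_scope.

Definition numerical_semigroup (S : set nat) : Prop :=
  [/\ S 0%N,
      forall x y : nat, S x -> S y -> S (x + y)%N
    & finite_set (~` S)].

Definition generated (A : set nat) : set nat :=
  [set x | exists (m : nat) (a c : 'I_m -> nat),
     (forall i, A (a i)) /\ x = (\sum_(i < m) c i * a i)%N].

Definition minimal_generators (S G : set nat) : Prop :=
  generated G = S /\ forall H : set nat, H `<` G -> generated H <> S.

(* S regarded as a subset of the integers. *)
Definition intset (S : set nat) : set int := [set x%:Z | x in S].

Definition addset (A B : set int) : set int := [set x + y | x in A & y in B].

Definition is_maximum (A : set int) (x : int) : Prop :=
  A x /\ forall y, A y -> y <= x.

(* The default value 0 of xget is never used when S is a numerical semigroup:
   see FrobeniusP below. *)
Definition Frobenius (S : set nat) : int :=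
  xget 0 (is_maximum (~` intset S)).

Definition PF (S : set nat) : set int :=
  [set f | ~ intset S f /\
           forall s : nat, S s -> s <> 0%N -> intset S (f + s%:Z)].

(* fset_set is the genuine set of elements of PF S, as PF S is finite when S
   is a numerical semigroup: see finite_PF below. *)
Definition sg_type (S : set nat) : nat := #|` fset_set (PF S)|.

Definition Mset (S : set nat) : set int := intset S `\ 0.

Definition Kset (S : set nat) : set int :=
  [set z | ~ intset S (Frobenius S - z)].

Definition SminusK (S : set nat) : set int :=
  [set z | forall k, Kset S k -> intset S (z + k)].

Definition almost_symmetric (S : set nat) : Prop :=
  addset (Mset S) (Kset S) = Mset S.

Definition nearly_Gorenstein (S : set nat) : Prop :=
  Mset S `<=` addset (Kset S) (SminusK S).

(* Intended for n listing the minimal generators of S in increasing order. *)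
Definition NG_vector (S : set nat) (v : nat) (n : 'I_v -> nat)
    (f : 'I_v -> int) : Prop :=
  (forall i, PF S (f i)) /\
  (forall (g : int) (i : 'I_v), PF S g -> intset S ((n i)%:Z + f i - g)).

Lemma intsetE (S : set nat) (x : nat) : intset S x%:Z <-> S x.
Proof. by split=> [[y Sy [<-]]|Sx] //; exists x. Qed.

Lemma intset_ge0 (S : set nat) (z : int) : intset S z -> 0 <= z.
Proof. by case=> x _ <-. Qed.

Lemma numerical_semigroup_bound (S : set nat) : numerical_semigroup S ->
  exists N : nat, forall x : nat, (N <= x)%N -> S x.
Proof.
case=> _ _ /finite_seqP[s sE]; exists (\max_(x <- s) x).+1 => x Nx.
apply: contrapT => nSx; have : (~` S) x by [].
rewrite sE /= => xs; have := @leq_bigmax_seq _ s xpredT id x xs isT.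
by move=> /(leq_trans Nx); rewrite ltnn.
Qed.

Lemma FrobeniusP (S : set nat) : numerical_semigroup S ->
  is_maximum (~` intset S) (Frobenius S).
Proof.
move=> /numerical_semigroup_bound[N SN]; apply: xgetPex.
pose P := [pred m : nat | `[< ~ intset S (m%:Z - 1) >]].
have exP : exists m, P m.
  by exists 0%N; apply/asboolP => /intset_ge0.
have ubP m : P m -> (m <= N)%N.
  move=> /asboolP nS; rewrite leqNgt; apply/negP => Nm; apply: nS.
  case: m Nm => // m Nm; rewrite -addn1 PoszD addrK.
  exact/intsetE/SN.
case: (ex_maxnP exP ubP) => m /asboolP Pm mmax.
exists (m%:Z - 1); split=> // -[y|y] nSy; last first.
  by rewrite NegzE lerBrDr -addn1 PoszD opprD addrNK (le_trans (y := 0)) ?oppr_le0.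
have /mmax : P y.+1 by apply/asboolP; rewrite -addn1 PoszD addrK.
by move=> ym; rewrite lerBrDr -(PoszD y 1) addn1 lez_nat.
Qed.

Lemma finite_PF (S : set nat) : numerical_semigroup S -> finite_set (PF S).
Proof.
move=> nS; have [_ _ finS] := nS.
have [N SN] := numerical_semigroup_bound nS.
apply: (@sub_finite_set _ _
  ((Posz @` (~` S)) `|` ((fun m : nat => - m%:Z) @` `I_N.+2))).
  case=> y [nSy ySs]; first by left; exists y => //; move=> /intsetE.
  right; exists y.+1; last by rewrite NegzE.
  have /intset_ge0 := ySs N.+1 (SN _ (leqnSn _)) (fun e => ltac:(discriminate e)).
  by rewrite NegzE addrC subr_ge0 lez_nat.
by rewrite finite_setU; split; apply: finite_image => //; exact: finite_II.
Qed.

(* Main.v *)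
(* Almost symmetric case.  If [f <> F] is in [PF S], then so is [F - f], and at
   most one of [f + n_a - n_b] and [F - f + n_b - n_a] lies in [S], as their sum
   is [F].  Each row [f + n_a] involves some generator; a row involving [n_c]
   only is a multiple of [n_c], and two such rows of [f] and [g] with the same
   [c] coincide: [f + n_a = g + n_b].  Counting the twelve pairs [(a, b)], the
   one-generator rows of [f] and [F - f] (if [f <> F - f]) meet all four
   generators [n_c], with no pair to spare; a third element [g <> F] would have,
   up to replacing it by [F - g], a one-generator row colliding with one of
   them, which wastes one more pair.  Hence [PF S] is [{F, f, F - f}].

   Otherwise [f_i = F - n_i + n_l] with [l < i], and [X = F + n_l = f_i + n_i]
   satisfies [X - g \in S] for every [g] in [PF S].  As [F] and [f_i] are not in
   [S], no factorization of [X] involves [n_l] or [n_i]; so if [g] differs from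
   [F] and [f_i], then [g + n_j] is a multiple of [n_k] for some ordering [j, k]
   of the two other indices, and two such [g] are equal. *)

Require Import Defs.
From mathcomp Require Import all_boot all_order all_algebra.
From mathcomp Require Import finmap zify.
From mathcomp Require Import boolp classical_sets functions cardinality.

Set Implicit Arguments.
Unset Strict Implicit.
Unset Printing Implicit Defensive.

Import Order.TTheory GRing.Theory Num.Theory.

(** * Counting the ordered pairs used by two families of rows *)

Section ArcCounting.
Local Open Scope set_scope.
Variable I : finType.
Implicit Types D E : I -> {set I}.

Definition single_heads D : {set I} := [set b | [exists a, D a == [set b]]].

(** A nonempty row counts for two unless it is a singleton; then its head supplies the missing unit,
    and by injectivity distinct singleton rows have distinct heads. *)
Lemma card_single_heads D :
  (forall a, D a != finset.set0) ->
  (forall a b c, D a = [set c] -> D b = [set c] -> a = b) ->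
  (#|I|.*2 <= (\sum_a #|D a|) + #|single_heads D|)%N.
Proof.
move=> D0 Dinj; pose s := [set a | #|D a| == 1%N].
have s_le : (#|s| <= #|single_heads D|)%N.
  rewrite -(@card_in_imset _ _ D s).
    rewrite -(card_imset (single_heads D) (@set1_inj I)).
    apply/subset_leq_card/fintype.subsetP => _ /imsetP[a + ->].
    rewrite inE => /cards1P[b Dab]; rewrite Dab; apply: imset_f.
    by rewrite inE; apply/existsP; exists a; apply/eqP.
  move=> a b; rewrite inE => /cards1P[c Dac] _ Dab.
  by apply: (Dinj a b c) => //; rewrite -Dab.
rewrite -muln2 -sum_nat_const.
apply: (@leq_trans (\sum_a (#|D a| + (a \in s)))%N).
  apply: leq_sum => a _; rewrite inE.
  by have := D0 a; rewrite -card_gt0; lia.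
by rewrite big_split /= leq_add2l -big_mkcond sum1_card.
Qed.

(** Reading [E] transposed, each off-diagonal pair [(a, b)] is charged at most once: to [W], to
    [b \in D a] or to [a \in E b]. *)
Lemma card_arcs D E (W : {set I * I}) :
  (forall a, a \notin D a) -> (forall a, a \notin E a) ->
  (forall a b, b \in D a -> a \notin E b) ->
  (forall a b, (a, b) \in W -> [/\ a != b, b \notin D a & a \notin E b]) ->
  (#|W| + (\sum_a #|D a|) + (\sum_a #|E a|) <= #|I| * #|I|.-1)%N.
Proof.
move=> Dirr Eirr DE Wout.
have -> : #|W| = (\sum_a \sum_b ((a, b) \in W))%N.
  rewrite pair_big /= -sum1_card big_mkcond /=.
  by apply: eq_bigr => -[a b] _; case: ifP.
have -> : (\sum_a #|D a| = \sum_a \sum_b (b \in D a))%N.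
  by apply: eq_bigr => a _; rewrite -sum1_card big_mkcond.
have -> : (\sum_a #|E a| = \sum_a \sum_b (a \in E b))%N.
  rewrite exchange_big; apply: eq_bigr => b _.
  by rewrite -sum1_card big_mkcond.
rewrite -!big_split /= -[X in (_ <= X)%N]sum_nat_const; apply: leq_sum => a _.
rewrite -!big_split /= -(cardC1 a) -sum1_card [X in (_ <= X)%N]big_mkcond.
apply: leq_sum => b _; rewrite !inE.
have := @Wout a b; have := @DE a b; have := Dirr a; have := Eirr a.
have [->|ba] := eqVneq b a.
  by move=> /negbTE-> /negbTE->; case: (_ \in W) => // _ [].
move=> _ _; case: (b \in D a) => [/(_ isT) /negbTE->|_].
  by case: (_ \in W) => // /(_ isT)[].
by case: (_ \in W) => [/(_ isT)[_ _ /negbTE->]|_] //; case: (_ \in _).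
Qed.

End ArcCounting.

(** * Two opposite families of four rows *)

Section FourRows.
Local Open Scope set_scope.
Variables D E : 'I_4 -> {set 'I_4}.
Hypothesis D0 : forall a, D a != finset.set0.
Hypothesis E0 : forall a, E a != finset.set0.
Hypothesis Dirr : forall a, a \notin D a.
Hypothesis Eirr : forall a, a \notin E a.
Hypothesis DE : forall a b, b \in D a -> a \notin E b.
Hypothesis Dinj :
  forall a b c, D a = [set c] -> D b = [set c] -> a = b.
Hypothesis Einj :
  forall a b c, E a = [set c] -> E b = [set c] -> a = b.

(** The two families ask for 8 + 8 units and only twelve pairs are available, so heads supply the
    other four, plus one for each pair wasted in [W]. *)
Lemma card_missing_arcs (W : {set 'I_4 * 'I_4}) :
  (forall a b, (a, b) \in W -> [/\ a != b, b \notin D a & a \notin E b]) ->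
  (#|W| + 4 <= #|single_heads D :|: single_heads E|
               + #|single_heads D :&: single_heads E|)%N.
Proof.
move=> /(card_arcs Dirr Eirr DE); rewrite cardsUI.
have := card_single_heads D0 Dinj; have := card_single_heads E0 Einj.
rewrite !card_ord.
move: (\sum_a _)%N (\sum_a _)%N #|W| #|single_heads D| #|single_heads E|.
lia.
Qed.

Lemma exists_single_row :
  exists a b : 'I_4, D a = [set b] \/ E a = [set b].
Proof.
have /card_missing_arcs : forall a b : 'I_4, (a, b) \in finset.set0 ->
    [/\ a != b, b \notin D a & a \notin E b].
  by move=> a b; rewrite inE.
rewrite cards0 cardsUI => /(@leq_trans 4 1 _ isT).
rewrite addn_gt0 !card_gt0 => /orP[] /set0Pn[b].
  by rewrite inE => /existsP[a /eqP ab]; exists a, b; left.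
by rewrite inE => /existsP[a /eqP ab]; exists a, b; right.
Qed.

Hypothesis DEcol :
  forall a b c, D a = [set c] -> E b = [set c] -> a != b.

(* Each column with a single row in both [D] and [E] costs one of the twelve
   pairs: then neither [b \in D a] nor [a \in E b].  So the number of columns
   met by single rows is at least four, and no further pair may be lost. *)
Lemma single_rows_tight :
  (forall c, exists a, D a = [set c] \/ E a = [set c]) /\
  (forall a b, a != b -> b \notin D a -> a \notin E b ->
     exists c, D a = [set c] /\ E b = [set c]).
Proof.
pose W0 := [set p : 'I_4 * 'I_4 |
  [exists c, (D p.1 == [set c]) && (E p.2 == [set c])]].
have W0out a b :
    (a, b) \in W0 -> [/\ a != b, b \notin D a & a \notin E b].
  rewrite inE => /existsP[c /andP[/eqP/= Dac /eqP/= Ebc]].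
  split; first exact: DEcol Dac Ebc.
    rewrite Dac inE; apply/eqP => bc; have := Eirr b.
    by rewrite Ebc inE bc eqxx.
  rewrite Ebc inE; apply/eqP => ac; have := Dirr a.
  by rewrite Dac inE ac eqxx.
have W0ge : (#|single_heads D :&: single_heads E| <= #|W0|)%N.
  rewrite -(card_imset _ (@set1_inj 'I_4)).
  (* Through [D p.1], the pairs of [W0] reach the singleton of every common head. *)
  apply: leq_trans (leq_imset_card (fun p => D p.1) W0).
  apply/subset_leq_card/fintype.subsetP => _ /imsetP[c + ->].
  rewrite !inE => /andP[/existsP[a /eqP Da] /existsP[b /eqP Eb]].
  apply/imsetP; exists (a, b) => //; rewrite inE; apply/existsP; exists c.
  by rewrite Da Eb !eqxx.
split=> [c|a b ab Dab Eba].
  have /eqP/setP/(_ c) : single_heads D :|: single_heads E == [set: 'I_4].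
    rewrite eqEcard finset.subsetT /= cardsT card_ord -(leq_add2l #|W0|).
    by apply: leq_trans (card_missing_arcs W0out) _; rewrite addnC leq_add2r.
  rewrite !inE => /orP[] /existsP[a /eqP Da].
    by exists a; left.
  by exists a; right.
have [|abW] := boolP ((a, b) \in W0).
  by rewrite inE => /existsP[c /andP[/eqP Da /eqP Eb]]; exists c.
have /card_missing_arcs : forall x y, (x, y) \in (a, b) |: W0 ->
    [/\ x != y, y \notin D x & x \notin E y].
  by move=> x y /setU1P[[-> ->]//|]; exact: W0out.
rewrite cardsU1 abW => /leq_trans/(_ (leq_add (max_card _) W0ge)).
by rewrite card_ord addnC leq_add2l ltnn.
Qed.

End FourRows.

Local Open Scope classical_set_scope.
Local Open Scope ring_scope.

(** * Generated submonoids and minimal generators *)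

Section Generated.
Implicit Types (A H : set nat).

Lemma generated0 A : generated A 0%N.
Proof.
by exists 0%N, (fun=> 0%N), (fun=> 0%N); split=> [[]|] //; rewrite big_ord0.
Qed.

Lemma generatedD A x y :
  generated A x -> generated A y -> generated A (x + y)%N.
Proof.
move=> [p [a [c [Aa ->]]]] [q [b [d [Ab ->]]]].
pose glue (u : 'I_p -> nat) (w : 'I_q -> nat) (i : 'I_(p + q)) :=
  match fintype.split i with inl j => u j | inr j => w j end.
exists (p + q)%N, (glue a b), (glue c d); split.
  by move=> i; rewrite /glue; case: fintype.split.
rewrite big_split_ord /=; congr addn; apply: eq_bigr => i _; rewrite /glue.
  by rewrite (unsplitK (inl i)).
by rewrite (unsplitK (inr i)).
Qed.

Lemma generated_muln A c x : generated A x -> generated A (c * x)%N.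
Proof.
move=> Ax; elim: c => [|c IH]; first exact: generated0.
by rewrite mulSn; exact: generatedD.
Qed.

Lemma sub_generated A : A `<=` generated A.
Proof.
move=> x Ax; exists 1%N, (fun=> x), (fun=> 1%N); split=> //.
by rewrite big_ord1 mul1n.
Qed.

Lemma generated_sum A I (r : seq I) (c a : I -> nat) :
  (forall i, generated A (c i * a i)%N) ->
  generated A (\sum_(i <- r) c i * a i)%N.
Proof.
by move=> Aca; elim/big_ind : _ => //; [exact: generated0 | exact: generatedD].
Qed.

Lemma generated_sub A H : A `<=` generated H -> generated A `<=` generated H.
Proof.
move=> AH _ [m [a [c [Aa ->]]]]; apply: generated_sum => i.
exact/generated_muln/AH.
Qed.

Lemma minimal_generator_out S G g : minimal_generators S G -> G g ->
  ~ generated (G `\ g) g.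
Proof.
move=> [GS Gmin] Gg Hg; apply: (Gmin (G `\ g)).
  split; first exact: subDsetl.
  by move=> /(_ g Gg)[_]; apply.
rewrite -GS; apply/seteqP; split; apply: generated_sub => x.
  by case=> Gx _; exact: sub_generated.
have [->//|xg Gx] := eqVneq x g.
by apply: sub_generated; split=> //; exact/eqP.
Qed.

Lemma generated_lt A g x : (x < g)%N -> generated A x -> generated (A `\ g) x.
Proof.
move=> xg [m [a [c [Aa xE]]]]; rewrite xE; apply: generated_sum => i.
have [->|ci0] := posnP (c i); first exact: generated0.
apply: generated_muln; apply: sub_generated; split => //= aig.
move: xg; rewrite ltnNge => /negP; apply.
rewrite xE (bigD1 i) //= aig; apply: leq_trans (leq_addr _ _).
by rewrite leq_pmull.
Qed.

End Generated.

(** * Subtracting generators, and pseudo-Frobenius numbers *)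

Section Semigroup.
Variables (S : set nat) (v : nat) (n : 'I_v -> nat).
Hypothesis nS : numerical_semigroup S.
Hypothesis n_inj : injective n.
Hypothesis nmin : minimal_generators S (range n).

Local Notation T := (intset S).
Local Notation N i := ((n i)%:Z).
Local Notation F := (Frobenius S).

Lemma intset0 : T 0.
Proof. by case: nS => S0 _ _; exists 0%N. Qed.

Lemma intsetD x y : T x -> T y -> T (x + y).
Proof.
case: nS => _ SD _ [a Sa <-] [b Sb <-]; exists (a + b)%N; first exact: SD.
by rewrite PoszD.
Qed.

Lemma intset_mulrn x k : T x -> T (x *+ k).
Proof.
move=> Tx; elim: k => [|k IH]; first exact: intset0.
by rewrite mulrS; exact: intsetD.
Qed.

Lemma intset_gen i : T (N i).
Proof.
exists (n i) => //; case: nmin => <- _; apply: sub_generated.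
by exists i.
Qed.

Lemma gen_gt0 i : 0 < N i.
Proof.
have ri : range n (n i) by exists i.
rewrite ltz_nat lt0n; apply/eqP => ni0; apply: (minimal_generator_out nmin ri).
by rewrite ni0; exact: generated0.
Qed.

Lemma intset_decomp z : T z -> z <> 0 -> exists i, T (z - N i).
Proof.
case=> x + <-; case: nmin => [GS _]; rewrite -[in X in X -> _]GS.
case=> m [a [c [ra ->]]] sum0.
have [i ci0] : exists i, (c i * a i != 0)%N.
  apply: contrapT => nci; apply: sum0; congr Posz; apply: big1 => i _.
  by apply/eqP; apply: contrapT => /negP ci; apply: nci; exists i.
have [j _ nj] := ra i; exists j.
have ci : (0 < c i)%N by case: (c i) ci0.
rewrite (bigD1 i) //= -(prednK ci) mulSn -nj -addnA PoszD [N j + _]addrC addrK.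
apply/intsetE; rewrite -GS; apply: generatedD.
  by apply: generated_muln; apply: sub_generated; exists j.
by rewrite -big_filter; apply: generated_sum => k;
  exact/generated_muln/sub_generated.
Qed.

(** If [n_i = n_j + w] with [i <> j], then [w < n_i] is generated without [n_i], hence so is [n_i],
    against minimality. *)
Lemma gen_sub_out i j : T (N i - N j) -> i = j.
Proof.
move=> [w Sw wE]; have nE : n i = (n j + w)%N by lia.
apply: n_inj; apply: contrapT => nij.
apply: (minimal_generator_out nmin (g := n i)); first by exists i.
rewrite {2}nE; apply: generatedD.
  by apply: sub_generated; split; [exists j | move=> /= /esym].
apply: generated_lt; first by have := gen_gt0 j; lia.
by case: nmin => -> _.
Qed.

Lemma gen_irreducible i w : T w -> T (N i - w) -> w = 0 \/ w = N i.
Proof.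
move=> Tw Tiw; have [->|/eqP w0] := eqVneq w 0; first by left.
right; have [j Tj] := intset_decomp Tw w0.
have /gen_sub_out ij : T (N i - N j).
  by rewrite (_ : _ - _ = (N i - w) + (w - N j)); [exact: intsetD | lia].
have := intset_ge0 Tiw; have := intset_ge0 Tj; rewrite -ij; lia.
Qed.

(** The hypothesis passes from [z] to [z - n_j], since a generator that can be taken off the latter
    can be taken off [z]. *)
Lemma multiple_of_gen z j :
  T z -> (forall i, T (z - N i) -> i = j) -> exists m : nat, z = N j *+ m.
Proof.
case=> x + <-; elim/ltn_ind: x => x IH Sx onlyj.
have [->|/eqP x0] := eqVneq x 0%N; first by exists 0%N.
have [||i Ti] := @intset_decomp x%:Z; [exact/intsetE|lia|].
have ij := onlyj i Ti; rewrite ij in Ti.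
have [y Sy yE] := Ti; have := gen_gt0 j => nj.
have [|k Tk|m ym] := IH y _ Sy; first by lia.
  apply: onlyj; rewrite (_ : _ - _ = (y%:Z - N k) + N j); last by lia.
  exact/intsetD/intset_gen.
by exists m.+1; rewrite mulrS -ym yE; lia.
Qed.

Lemma Frobenius_out : ~ T F.
Proof. by have [] := FrobeniusP nS. Qed.

Lemma Frobenius_ge z : ~ T z -> z <= F.
Proof. by have [_] := FrobeniusP nS; exact. Qed.

Lemma PF_out g : PF S g -> ~ T g.
Proof. by case. Qed.

Lemma PF_add g s : PF S g -> T s -> s <> 0 -> T (g + s).
Proof.
by move=> [_ gS] [x Sx <-] x0; apply: gS => // xz; apply: x0; rewrite xz.
Qed.

Lemma PF_gen g i : PF S g -> T (g + N i).
Proof.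
move=> PFg; apply: PF_add => //; first exact: intset_gen.
by have := gen_gt0 i; lia.
Qed.

Lemma PF_intro g : ~ T g -> (forall i, T (g + N i)) -> PF S g.
Proof.
move=> nTg gN; split=> // s Ss s0.
have [||i Ti] := @intset_decomp s%:Z; [exact/intsetE|lia|].
rewrite (_ : _ + _ = (g + N i) + (s%:Z - N i)); first exact: intsetD.
by lia.
Qed.

Lemma PF_Frobenius : PF S F.
Proof.
apply: PF_intro => [|i]; first exact: Frobenius_out.
apply: contrapT => /Frobenius_ge; have := gen_gt0 i; lia.
Qed.

Lemma PF_antichain g h : PF S g -> PF S h -> T (h - g) -> h = g.
Proof.
move=> PFg PFh Thg; apply: contrapT => hg.
apply: (PF_out PFh); rewrite (_ : h = g + (h - g)); last by lia.
by apply: PF_add => //; lia.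
Qed.

(** The difference of [g] and [h] is, up to sign, a multiple of [n_j], and [PF S] is an antichain
    for the order given by [S]. *)
Lemma PF_multiples g h x j (p q : nat) : PF S g -> PF S h ->
  g + x = N j *+ p -> h + x = N j *+ q -> g = h.
Proof.
have le g' h' (p' q' : nat) : PF S g' -> PF S h' -> (p' <= q')%N ->
    g' + x = N j *+ p' -> h' + x = N j *+ q' -> g' = h'.
  move=> PFg PFh pq gE hE; apply/esym/PF_antichain => //.
  rewrite (_ : h' - g' = (h' + x) - (g' + x)); last by lia.
  rewrite gE hE -mulrnBr //.
  exact/intset_mulrn/intset_gen.
move=> PFg PFh gE hE; have [pq|/ltnW qp] := leqP p q; first exact: le gE hE.
by apply/esym; exact: le hE gE.
Qed.

(** Adding generators while staying outside [S] must stop, as [F] bounds the complement; it stops at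
    a pseudo-Frobenius number. *)
Lemma PF_above z : ~ T z -> exists2 g, PF S g & T (g - z).
Proof.
have [k] := ubnP (`|F - z|)%N; elim: k z => // k IH z zk nTz.
have [zN|/existsNP[i nTi]] := pselect (forall i, T (z + N i)).
  by exists z; [exact: PF_intro | rewrite subrr; exact: intset0].
have zF := Frobenius_ge nTi; have n0 := gen_gt0 i.
have [|g PFg Tg] := IH _ _ nTi; first by lia.
exists g => //; rewrite (_ : g - z = (g - (z + N i)) + N i); last by lia.
exact/intsetD/intset_gen.
Qed.

End Semigroup.

Lemma sg_type_le3 S (a b c : int) : numerical_semigroup S ->
  PF S `<=` [set a; b; c] -> (sg_type S <= 3)%N.
Proof.
move=> nS sub; rewrite /sg_type.
apply: (@leq_trans #|` [fset x in [:: a; b; c]]%fset|); last first.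
  by rewrite card_fseq size_undup.
apply/fsubset_leq_card/fsubsetP => x.
rewrite in_fset_set; last exact: finite_PF.
by move=> /set_mem/sub[[/= ->|/= ->]|/= ->]; rewrite !inE eqxx ?orbT.
Qed.

(** * Almost symmetric semigroups with four generators *)

Section FourGenerators.
Variables (S : set nat) (n : 'I_4 -> nat).
Hypothesis nS : numerical_semigroup S.
Hypothesis n_inj : injective n.
Hypothesis nmin : minimal_generators S (range n).

Local Notation T := (intset S).
Local Notation N i := ((n i)%:Z).
Local Notation F := (Frobenius S).

(* [b \in arcs f a] when [n_b] occurs in some factorization of [f + n_a]: the
   possible supports of row [a] of a row-factorization matrix of [f]. *)
Definition arcs (f : int) (a : 'I_4) : {set 'I_4} :=
  [set b | `[< T (f + N a - N b) >]]%SET.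

Lemma arcsP f a b : reflect (T (f + N a - N b)) (b \in arcs f a).
Proof. by rewrite inE; exact: asboolP. Qed.

Lemma arcs_neq0 f : PF S f -> forall a, arcs f a != finset.set0.
Proof.
move=> PFf a; have [fa|b Tb] := intset_decomp nmin (PF_gen nmin a PFf).
  (* If [f + n_a] were 0, then [f + n_b = n_b - n_a] would lie in [S] for an index [b] other than
     [a]. *)
  have /eqP[] := neq_lift a ord0; apply/esym.
  apply: (gen_sub_out n_inj nmin); have := PF_gen nmin (lift a ord0) PFf.
  by rewrite (_ : f = - N a) 1?addrC //; lia.
by apply/set0Pn; exists b; exact/arcsP.
Qed.

Lemma arcs_irrefl f : PF S f -> forall a, a \notin arcs f a.
Proof. by move=> PFf a; apply/arcsP; rewrite addrK; exact: PF_out. Qed.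

Lemma arcs1_multiple f a c : PF S f -> arcs f a = [set c]%SET ->
  exists2 p : nat, f + N a = N c *+ p & (0 < p)%N.
Proof.
move=> PFf fac.
have [i Ti|p pE] := multiple_of_gen nS nmin (z := f + N a) (j := c)
  (PF_gen nmin a PFf).
  by apply/set1P; rewrite -fac; exact/arcsP.
exists p => //; rewrite lt0n; apply/eqP => p0.
have /arcsP : c \in arcs f a by rewrite fac set11.
rewrite pE p0 mulr0n => /intset_ge0; have := gen_gt0 nmin c; lia.
Qed.

(** Both sides are positive multiples of [n_c]. If the first were smaller, [n_a] could be taken off
    [g + n_b], leaving [f + n_c] plus a multiple of [n_c]; then [a = c], so row [a] of [f] would
    contain [a]. *)
Lemma arcs1_eq f g a b c : PF S f -> PF S g ->
  arcs f a = [set c]%SET -> arcs g b = [set c]%SET -> f + N a = g + N b.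
Proof.
have nlt f' g' a' b' (p q : nat) : PF S f' -> (0 < p)%N ->
    arcs f' a' = [set c]%SET -> arcs g' b' = [set c]%SET ->
    f' + N a' = N c *+ p -> g' + N b' = N c *+ q -> ~ (p < q)%N.
  move=> PFf p0 fac gbc pE qE pq.
  have : a' \in arcs g' b'.
    apply/arcsP.
    have -> : g' + N b' - N a' = (f' + N c) + N c *+ (q - p).-1.
      have := mulrnBr (N c) (ltnW pq); rewrite -pE -qE.
      by rewrite -[in X in X -> _](@prednK (q - p)%N) ?subn_gt0 // mulrS; lia.
    apply: (intsetD nS); first exact: (PF_gen nmin _ PFf).
    exact/(intset_mulrn nS)/(intset_gen nmin).
  rewrite gbc => /set1P ac; have := arcs_irrefl PFf a'.
  by rewrite fac ac set11.
move=> PFf PFg fac gbc.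
have [p pE p0] := arcs1_multiple PFf fac.
have [q qE q0] := arcs1_multiple PFg gbc.
suff pq : p = q by rewrite pE qE pq.
case: (ltngtP p q) => // lt_pq.
  by case: (nlt f g a b p q).
by case: (nlt g f b a q p).
Qed.

Lemma arcs1_row f g : PF S f -> PF S g -> f <> g ->
  forall a b c,
    arcs f a = [set c]%SET -> arcs g b = [set c]%SET -> a != b.
Proof.
move=> PFf PFg fg a b c fac gbc; apply/eqP => ab; apply: fg.
by apply: (addIr (N a)); rewrite (arcs1_eq PFf PFg fac gbc) ab.
Qed.

Lemma arcs1_inj f : PF S f ->
  forall a b c, arcs f a = [set c]%SET -> arcs f b = [set c]%SET -> a = b.
Proof.
by move=> PFf a b c fac fbc; have /addrI[/n_inj] := arcs1_eq PFf PFf fac fbc.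
Qed.

Lemma arcs_opposite f a b : b \in arcs f a -> a \notin arcs (F - f) b.
Proof.
move=> /arcsP Tf; apply/arcsP => Tf'; apply: (Frobenius_out nS).
rewrite (_ : F = (f + N a - N b) + (F - f + N b - N a)); last by lia.
exact: (intsetD nS).
Qed.

Hypothesis aS : almost_symmetric S.

(** As [g] is not in [S], [F - g] lies in [K], and [M + K = M] puts every [n_i + (F - g)] in [S]. *)
Lemma almost_symmetric_PF g : PF S g -> g <> F -> PF S (F - g).
Proof.
move=> PFg gF; apply: (PF_intro nS nmin) => [|i].
  by move=> /(PF_antichain PFg (PF_Frobenius nS nmin))/esym.
have : addset (Mset S) (Kset S) (N i + (F - g)).
  exists (N i); first split; first exact: (intset_gen nmin).
    by have := gen_gt0 nmin i => /= ? ?; lia.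
  exists (F - g) => //; rewrite /Kset /= subKr; exact: PF_out.
by rewrite aS addrC => -[].
Qed.

(** From [f + n_a = g + n_b], the pair [(a, b)] is lost for [f] and [F - f], because
    [F - f + n_b - n_a = F - g]. Tightness then makes row [b] of [F - f] equal to [{c}], as for [g],
    which forces [F - f = g]. *)
Lemma single_row_collision f g a b c : PF S f -> PF S g ->
  f <> F -> g <> F -> f <> F - f -> F - f <> g -> f <> g ->
  arcs f a = [set c]%SET -> arcs g b = [set c]%SET -> False.
Proof.
move=> PFf PFg fF gF ff fg' fg fac gbc.
have PFf' := almost_symmetric_PF PFf fF.
have PFg' := almost_symmetric_PF PFg gF.
have [_ /(_ a b)] := single_rows_tight (arcs_neq0 PFf) (arcs_neq0 PFf')
  (arcs_irrefl PFf) (arcs_irrefl PFf') (@arcs_opposite _)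
  (arcs1_inj PFf) (arcs1_inj PFf') (arcs1_row PFf PFf' ff).
have ab := arcs1_row PFf PFg fg fac gbc.
have bc : b \notin [set c]%SET.
  by apply/set1P => bc; have := arcs_irrefl PFg b; rewrite gbc bc set11.
rewrite {1}fac => /(_ ab bc)[|d []].
  apply/arcsP; rewrite (_ : _ - _ = F - g); first exact: PF_out.
  by have := arcs1_eq PFf PFg fac gbc; lia.
rewrite fac => /set1_inj <- /(arcs1_row PFf' PFg fg')/(_ gbc).
by rewrite eqxx.
Qed.

Lemma almost_symmetric_PF_sub f g : PF S f -> f <> F -> f <> F - f ->
  PF S g -> [\/ g = F, g = f | g = F - f].
Proof.
move=> PFf fF ff PFg.
have [->|/eqP gF] := eqVneq g F; first by constructor 1.
have [->|/eqP gf] := eqVneq g f; first by constructor 2.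
have [->|/eqP gf'] := eqVneq g (F - f); [by constructor 3 | exfalso].
have PFf' := almost_symmetric_PF PFf fF.
have PFg' := almost_symmetric_PF PFg gF.
have nF h : PF S h -> F - h <> F.
  move=> PFh hF; apply: (PF_out PFh); rewrite (_ : h = 0); last by lia.
  exact: intset0.
have f'F := nF f PFf; have g'F := nF g PFg.
have [a [c]] := exists_single_row (arcs_neq0 PFg) (arcs_neq0 PFg')
  (arcs_irrefl PFg) (arcs_irrefl PFg') (@arcs_opposite _)
  (arcs1_inj PFg) (arcs1_inj PFg').
have [/(_ c)[b fb] _] := single_rows_tight (arcs_neq0 PFf) (arcs_neq0 PFf')
  (arcs_irrefl PFf) (arcs_irrefl PFf') (@arcs_opposite _)
  (arcs1_inj PFf) (arcs1_inj PFf') (arcs1_row PFf PFf' ff).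
(* Column [c] is met by [f] or [F - f], and by [g] or [F - g]: each of the four combinations is a
   collision. *)
case: fb => + []; apply: single_row_collision => //; lia.
Qed.

Lemma almost_symmetric_type : (sg_type S <= 3)%N.
Proof.
have [[f [PFf fF ff]]|nf] :=
    pselect (exists f, [/\ PF S f, f <> F & f <> F - f]).
  apply: (@sg_type_le3 _ F f (F - f)) => // g PFg.
  by case: (almost_symmetric_PF_sub PFf fF ff PFg) => ->;
    [left; left | left; right | right].
(* What remains has at most one element besides [F], namely half of [F]. *)
have half f : PF S f -> f <> F -> f = F - f.
  by move=> PFf fF; apply: contrapT => ff; apply: nf; exists f.
have [[f [PFf fF]]|nfF] := pselect (exists f, PF S f /\ f <> F).
  apply: (@sg_type_le3 _ F F f) => // g PFg; have [->|/eqP gF] := eqVneq g F.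
    by left; left.
  by right => /=; have := half _ PFf fF; have := half _ PFg gF; lia.
apply: (@sg_type_le3 _ F F F) => // g PFg; right => /=.
by apply: contrapT => gF; apply: nfF; exists g.
Qed.

End FourGenerators.

(** * NG-vectors *)

Section NearlyGorenstein.
Variables (S : set nat) (v : nat) (n : 'I_v -> nat).
Hypothesis nS : numerical_semigroup S.
Hypothesis n_inj : injective n.
Hypothesis nmin : minimal_generators S (range n).

Local Notation T := (intset S).
Local Notation N i := ((n i)%:Z).
Local Notation F := (Frobenius S).

(** The hypothesis says that the constant vector [F] is an NG-vector. For [z] in [K], some [g] in
    [PF S] lies above [F - z], and [n_i + z] is the sum of [n_i + F - g] and [g - (F - z)]. *)
Lemma almost_symmetric_intro :
  (forall i g, PF S g -> T (N i + F - g)) -> almost_symmetric S.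
Proof.
move=> NF; apply/seteqP.
split=> [_ [s [Ts s0] [z Kz <-]]|s [Ts s0]]; last first.
  exists s => //; exists 0; last by rewrite addr0.
  by rewrite /Kset /= subr0; exact: Frobenius_out.
split; last first.
  move=> /= sz; apply: Kz; rewrite (_ : F - z = F + s); last by lia.
  exact: PF_add (PF_Frobenius nS nmin) Ts s0.
have [i Ti] := intset_decomp nmin Ts s0.
have [g PFg Tg] := PF_above nS nmin Kz.
rewrite (_ : s + z = (s - N i) + ((N i + F - g) + (g - (F - z)))); last by lia.
by apply: (intsetD nS) => //; apply: (intsetD nS) => //; exact: NF.
Qed.

Lemma NG_vector_exists : nearly_Gorenstein S -> exists f, NG_vector S n f.
Proof.
move=> ngS.
have /choice[f fP] i : exists f, PF S f /\ forall g, PF S g -> T (N i + f - g).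
  have [|k Kk [z Sz kz]] := ngS (N i).
    split; first exact: (intset_gen nmin).
    by have := gen_gt0 nmin i => /= ? ?; lia.
  (* With [n_i = k + z], the entry is any pseudo-Frobenius number above [F - k]; each [F - g] lies
     in [K], so [z + (F - g)] is in [S]. *)
  have [f PFf Tf] := PF_above nS nmin Kk; exists f; split=> // g PFg.
  rewrite (_ : _ - g = (z + (F - g)) + (f - (F - k))); last by lia.
  apply: (intsetD nS) => //; apply: Sz; rewrite /Kset /= subKr.
  exact: PF_out.
by exists f; split=> [i|g i]; have [] := fP i; auto.
Qed.

Hypothesis n_mono : forall a b : 'I_v, (a < b)%N -> (n a < n b)%N.
Variable f : 'I_v -> int.
Hypothesis NGf : NG_vector S n f.

Lemma gen_le_index a b : N a <= N b -> (a <= b)%N.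
Proof. by rewrite leqNgt lez_nat => nab; apply/negP => /n_mono; lia. Qed.

(** [n_i + f_i - F] is a nonzero element of [S] smaller than [n_i], so any generator taken off it
    has a smaller index. *)
Lemma NG_vector_shift i : f i <> F ->
  exists2 b : 'I_v, (b < i)%N & T (N i + f i - F - N b).
Proof.
have [PFf Tf] := NGf; move=> fF.
have fle : f i <= F by apply: (Frobenius_ge nS); exact: PF_out.
have [|b Tb] := intset_decomp nmin (Tf F i (PF_Frobenius nS nmin)).
  move=> e; apply: (Frobenius_out nS).
  by rewrite (_ : F = f i + N i); [exact: (PF_gen nmin) | lia].
have b0 := intset_ge0 Tb; exists b => //.
have := @gen_le_index b i; have : b <> i by move=> bi; rewrite bi in b0; lia.
move=> /eqP; rewrite -val_eqE ltn_neqAle /= => -> /=; apply; lia.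
Qed.

Lemma NG_vector_first (i : 'I_v) : i = 0%N :> nat -> f i = F.
Proof.
by move=> i0; apply: contrapT => /NG_vector_shift[b]; rewrite i0.
Qed.

(** Let [w = n_i + f_i - F - n_l] be in [S]. Minimality gives [f_l = F], so the NG condition at [l]
    puts [n_i - w] in [S]. Irreducibility of [n_i] leaves [w = 0], since [w = n_i] would give
    [f_i > F]. *)
Lemma NG_vector_min i : f i <> F -> (forall a, f a <> F -> (i <= a)%N) ->
  exists2 l : 'I_v, (l < i)%N & f i = F - N i + N l.
Proof.
have [PFf Tf] := NGf; move=> fF imin; have [l li Tl] := NG_vector_shift fF.
exists l => //.
have fl : f l = F by apply: contrapT => /imin; rewrite leqNgt li.
have fle : f i <= F by apply: (Frobenius_ge nS); exact: PF_out.
have := Tf (f i) l (PFf i); rewrite fl.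
rewrite (_ : _ - _ = N i - (N i + f i - F - N l)); last by lia.
have l0 := gen_gt0 nmin l.
by move=> /(gen_irreducible nS n_inj nmin Tl)[]; lia.
Qed.

End NearlyGorenstein.

(** * Pseudo-Frobenius numbers below an element avoiding two generators *)

Section TwoGenerators.
Variables (S : set nat) (n : 'I_4 -> nat).
Hypothesis nS : numerical_semigroup S.
Hypothesis nmin : minimal_generators S (range n).

Local Notation T := (intset S).
Local Notation N i := ((n i)%:Z).

Variables (X : int) (i l : 'I_4).
Hypothesis Xi : ~ T (X - N i).
Hypothesis Xl : ~ T (X - N l).

Definition covers j k := forall x : 'I_4, [\/ x = i, x = l, x = j | x = k].

Lemma covers_sym j k : covers j k -> covers k j.
Proof.
by move=> cov x; case: (cov x);
  [constructor 1 | constructor 2 | constructor 4 | constructor 3].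
Qed.

(** A generator taken off [g + n_j] can be taken off [X], which excludes [n_i] and [n_l]; [n_j] is
    excluded by [g] not being in [S]. *)
Lemma PF_lower_multiple j k g : covers j k -> PF S g -> T (X - g - N j) ->
  exists m : nat, g + N j = N k *+ m.
Proof.
move=> cov PFg Tg; apply: (multiple_of_gen nS nmin); first exact: (PF_gen nmin).
have no x : ~ T (X - N x) -> ~ T (g + N j - N x).
  move=> Xx Tx; apply: Xx.
  rewrite (_ : _ - _ = (g + N j - N x) + (X - g - N j)); last by lia.
  exact: (intsetD nS).
move=> x Tx; case: (cov x) => // xE; subst x; try by case: (no _ _ Tx).
by case: (PF_out PFg); rewrite -[g](addrK (N j)).
Qed.

Lemma PF_lower_pure j k g : covers j k -> PF S g -> T (X - g - N j) ->
  ~ T (X - g - N k) -> exists m : nat, X - g - N j = N j *+ m.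
Proof.
move=> cov PFg Tg nTg; apply: (multiple_of_gen nS nmin) => // x Tx.
have no y : ~ T (X - N y) -> ~ T (X - g - N j - N y).
  move=> Xy Ty; apply: Xy.
  rewrite (_ : _ - _ = (X - g - N j - N y) + (g + N j)); last by lia.
  by apply: (intsetD nS) => //; exact: (PF_gen nmin).
case: (cov x) => // xE; subst x; try by case: (no _ _ Tx).
case: nTg; rewrite (_ : _ - _ = (X - g - N j - N k) + N j); last by lia.
by apply: (intsetD nS) => //; exact: (intset_gen nmin).
Qed.

(** If both [g] and [h] admit the same index, [PF_multiples] applies. Otherwise
    [X = g + (A + 1) n_j = q n_j + B n_k] with [h + n_k = q n_j]: if [q <= A], then [n_k] can be
    taken off [X - g]; if [A < q], then [g] is in [S]. *)
Lemma PF_lower_unique j k g h : covers j k -> PF S g -> PF S h ->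
  T (X - g - N j) -> T (X - h - N k) -> g = h.
Proof.
move=> cov PFg PFh Tg Th; have cov' := covers_sym cov.
have [p pE] := PF_lower_multiple cov PFg Tg.
have [q qE] := PF_lower_multiple cov' PFh Th.
have [Tgk|nTgk] := pselect (T (X - g - N k)).
  have [m mE] := PF_lower_multiple cov' PFg Tgk.
  exact: (PF_multiples nS nmin PFg PFh mE qE).
have [Thj|nThj] := pselect (T (X - h - N j)).
  have [m mE] := PF_lower_multiple cov PFh Thj.
  exact: (PF_multiples nS nmin PFg PFh pE mE).
have [A AE] := PF_lower_pure cov PFg Tg nTgk.
have [B BE] := PF_lower_pure cov' PFh Th nThj.
have [qA|Aq] := leqP q A.
  case: nTgk; have := mulrnBr (N j) qA; rewrite -AE -qE => dE.
  rewrite (_ : _ - _ = N j *+ (A - q) + (h + N j)); last by lia.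
  apply: (intsetD nS); first exact/(intset_mulrn nS)/(intset_gen nmin).
  exact: (PF_gen nmin).
case: (PF_out PFg).
rewrite (_ : g = N j *+ (q - A.+1) + N k *+ B).
  by apply: (intsetD nS); exact/(intset_mulrn nS)/(intset_gen nmin).
by rewrite mulrnBr // mulrS -AE -BE -qE; lia.
Qed.

End TwoGenerators.

(** * The shape of the set of pseudo-Frobenius numbers *)

Section Shape.
Variables (S : set nat) (n : 'I_4 -> nat).
Hypothesis nS : numerical_semigroup S.
Hypothesis nmin : minimal_generators S (range n).

Local Notation T := (intset S).
Local Notation N i := ((n i)%:Z).
Local Notation F := (Frobenius S).

Lemma covers_exist (i l : 'I_4) : l != i -> exists j k, covers i l j k.
Proof.
move=> li; have : #|~: [set i; l]%SET| == 2.
  rewrite -(eqn_add2l #|[set i; l]%SET|) cardsC cards2 (eq_sym i) li.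
  by rewrite card_ord.
move=> /cards2P[j [k [_ /setP jk]]]; exists j, k => x.
have := jk x; rewrite !inE.
have [->|_] := eqVneq x i; first by constructor 1.
have [->|_] := eqVneq x l; first by constructor 2.
have [->|_] := eqVneq x j; first by constructor 3.
by move=> /= /esym/eqP->; constructor 4.
Qed.

Lemma PF_shape (i l : 'I_4) : l != i -> PF S (F - N i + N l) ->
  (forall g, PF S g -> T (F + N l - g)) ->
  exists j k (lam : nat), covers i l j k /\
   (PF S = [set F; F - N i + N l] \/
    PF S = [set F; F - N i + N l; lam%:Z * N k - N j]).
Proof.
move=> li PFh TX; have [j0 [k0 cov0]] := covers_exist li.
have PFF := PF_Frobenius nS nmin.
have Xl : ~ T (F + N l - N l) by rewrite addrK; exact: PF_out.
have Xi : ~ T (F + N l - N i) by rewrite addrAC; exact: PF_out.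
have lower j k g : covers i l j k -> PF S g -> g <> F ->
    g <> F - N i + N l -> T (F + N l - g - N j) \/ T (F + N l - g - N k).
  move=> cov PFg gF gh; have [|x Tx] := intset_decomp nmin (TX g PFg).
    by have := Frobenius_ge nS (PF_out PFg); have := gen_gt0 nmin l; lia.
  case: (cov x) => xE; subst x; [| |by left|by right]; exfalso.
    apply: gh; apply/esym/(PF_antichain PFg PFh).
    by rewrite (_ : _ - _ = F + N l - g - N i); last by lia.
  apply: gF; apply/esym/(PF_antichain PFg PFF).
  by rewrite (_ : _ - _ = F + N l - g - N l); last by lia.
have [[g [PFg gF gh]]|none] :=
    pselect (exists g, [/\ PF S g, g <> F & g <> F - N i + N l]); last first.
  (* The two-element form does not mention [lam], so 0 is a filler. *)
  exists j0, k0, 0%N; split=> //; left.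
  apply/seteqP; split=> [g PFg|g [->|->]] //.
  have [->|/eqP gF] := eqVneq g F; first by left.
  have [->|/eqP gh] := eqVneq g (F - N i + N l); first by right.
  by case: none; exists g.
have [j [k [cov Tg]]] : exists j k, covers i l j k /\ T (F + N l - g - N j).
  have [?|?] := lower _ _ _ cov0 PFg gF gh; first by exists j0, k0.
  by exists k0, j0; split=> //; exact: covers_sym.
have [m mE] := PF_lower_multiple nS nmin Xi Xl cov PFg Tg.
exists j, k, m; split=> //; right.
have gE : g = m%:Z * N k - N j by rewrite -natz mulr_natl -mE addrK.
rewrite -gE; apply/seteqP; split=> [h PFh'|h [[->|->]|->]] //.
have [->|/eqP hF] := eqVneq h F; first by left; left.
have [->|/eqP hh] := eqVneq h (F - N i + N l); first by left; right.
right => /=; have [Th|Th] := lower _ _ _ cov PFh' hF hh; last first.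
  by rewrite (PF_lower_unique nS nmin Xi Xl cov PFg PFh' Tg Th).
have [p pE] := PF_lower_multiple nS nmin Xi Xl cov PFh' Th.
exact: (PF_multiples nS nmin PFh' PFg pE mE).
Qed.

End Shape.

Theorem theorem2p4 (S : set nat) (n : 'I_4 -> nat)
  (hS : numerical_semigroup S)
  (hn : forall a b : 'I_4, (a < b)%N -> (n a < n b)%N)
  (hgen : minimal_generators S (range n))
  (hNG : nearly_Gorenstein S) :
  (sg_type S <= 3)%N /\
  (forall f : 'I_4 -> int, NG_vector S n f ->
   ~ almost_symmetric S ->
   forall i : 'I_4,
     f i <> f ord0 ->
     (forall a : 'I_4, f a <> f ord0 -> (i <= a)%N) ->
   exists l j k : 'I_4, exists lam : nat,
     [/\ (l < i)%N,
         [set i; j; k; l] = [set: 'I_4]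
       & PF S = [set Frobenius S; Frobenius S - (n i)%:Z + (n l)%:Z] \/
         PF S = [set Frobenius S; Frobenius S - (n i)%:Z + (n l)%:Z;
                     lam%:Z * (n k)%:Z - (n j)%:Z]]).
Proof.
have n_inj : injective n.
  move=> a b nab; apply/val_inj => /=.
  by case: (ltngtP a b) => // /hn; rewrite nab ltnn.
have shape f : NG_vector S n f -> forall i : 'I_4, f i <> f ord0 ->
    (forall a : 'I_4, f a <> f ord0 -> (i <= a)%N) ->
    exists l j k : 'I_4, exists lam : nat, [/\ (l < i)%N, covers i l j k
       & PF S = [set Frobenius S; Frobenius S - (n i)%:Z + (n l)%:Z] \/
         PF S = [set Frobenius S; Frobenius S - (n i)%:Z + (n l)%:Z;
                     lam%:Z * (n k)%:Z - (n j)%:Z]].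
  move=> NGf i; rewrite (NG_vector_first hS hgen hn NGf (i := ord0)) //.
  move=> fi imin; have [PFf Tf] := NGf.
  have [l li fE] := NG_vector_min hS n_inj hgen hn NGf fi imin.
  have [||g PFg|j [k [lam [cov sh]]]] := @PF_shape S n hS hgen i l.
  - by apply/eqP => il; rewrite il ltnn in li.
  - by rewrite -fE.
  - rewrite (_ : _ - g = (n i)%:Z + f i - g); last by lia.
    exact: Tf.
  by exists l, j, k, lam.
split; last first.
  move=> f NGf _ i fi imin.
  have [l [j [k [lam [li cov sh]]]]] := shape f NGf i fi imin.
  exists l, j, k, lam; split=> //; apply/seteqP; split=> // x _ /=.
  by case: (cov x); tauto.
have [aS|naS] := pselect (almost_symmetric S).
  exact: (almost_symmetric_type hS n_inj hgen).
have [f NGf] := NG_vector_exists hS hgen hNG; have [PFf Tf] := NGf.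
(* A constant NG-vector has all entries [F], which would make [S] almost symmetric. *)
have [i fi] : exists i, f i != f ord0.
  apply: contrapT => nf; apply: naS; apply: (almost_symmetric_intro hS hgen).
  move=> i g PFg; rewrite -(NG_vector_first hS hgen hn NGf (i := ord0)) //.
  suff <- : f i = f ord0 by exact: Tf.
  by apply: contrapT => /eqP fi; apply: nf; exists i.
have [m /eqP fm mmin] := @arg_minnP _ i (fun a => f a != f ord0) val fi.
have [|l [j [k [lam [_ _ sh]]]]] := shape f NGf m fm.
  by move=> a /eqP; exact: mmin.
case: sh => PFE.
  (* 0 only pads the two-element set to three. *)
  by apply: (sg_type_le3 (c := 0) hS); rewrite PFE => x; left; eassumption.
by apply: (sg_type_le3 hS); rewrite PFE; exact: subset_refl.
Qed.
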